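(* For every integer $t\ge 2$, there exists a $(12t+4,3,2)$-BIBD $(X,\mathcal{A})$ with a strong nesting $\phi:\mathcal{A}\to Y$, $X\subseteq Y$, where $|Y|=w=18t+7$, and this is optimal: no strong nesting of a $(12t+4,3,2)$-BIBD uses fewer points.
   Context: A $(v,k,\lambda)$-BIBD is a pair $(X,\mathcal{A})$ where $X$ is a set of $v$ points and $\mathcal{A}$ is a multiset of $k$-subsets of $X$ (blocks) such that every pair of distinct points lies in exactly $\lambda$ blocks. Given a $(v,k,\lambda)$-BIBD $(X,\mathcal{A})$ and a set $Y\supseteq X$ with $|Y|=w$, a map $\phi:\mathcal{A}\to Y$ is a strong nesting if (1) $\phi(A)\notin A$ for every block $A\in\mathcal{A}$, and (2) the multiset of pairs $\{\{x,\phi(A)\}: A\in\mathcal{A},\ x\in A\}$ (one pair for each block $A$, counted with multiplicity in $\mathcal{A}$, and each $x\in A$) consists of distinct pairs. A strong nesting is optimal if $w=|Y|$ is as small as possible. *)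

(* Defs.v *)
From mathcomp Require Import all_boot.
Set Implicit Arguments. Unset Strict Implicit. Unset Printing Implicit Defensive.

(* The superset Y is the whole finite type T (so |Y| = #|T|, X \subset Y).
   The multiset of blocks is an indexed family B : 'I_b -> {set T}
   (repeated blocks allowed), and a nesting is phi : 'I_b -> T,
   assigning a point to each block occurrence. *)

Definition is_BIBD (T : finType) (X : {set T}) (b : nat) (B : 'I_b -> {set T})
    (v k lam : nat) : Prop :=
  [/\ #|X| = v,
      (forall i, B i \subset X /\ #|B i| = k)
    & (forall x y, x \in X -> y \in X -> x != y ->
         #|[set i : 'I_b | (x \in B i) && (y \in B i)]| = lam)].

Definition strong_nesting (T : finType) (b : nat) (B : 'I_b -> {set T})
    (phi : 'I_b -> T) : Prop :=
  (forall i, phi i \notin B i) /\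
  (forall i j x y, x \in B i -> y \in B j ->
     [set x; phi i] = [set y; phi j] -> i = j /\ x = y).

(* Main.v *)
(* A design is encoded with its nesting as a list of quadruples (a, b, c; p): a block {a, b, c}
   nested at p, giving the three star pairs {a, p}, {b, p}, {c, p}. Relative to a symmetric
   relation R ("belong to different groups") every R-pair of block vertices must lie in
   exactly two blocks, every R-pair in at most one star, and all other pairs in none. Such
   designs glue together when their relations add up to a larger one.

   Existence. A frame4 of order r lives on 3r+1 groups, each made of four block vertices and
   two further points, so it has 12r+4 block vertices among 18r+6 points. Adding one point
   oo and putting the four triples of each group {0,1,2,3} in, nested at the two further
   points, at oo and at a point of the group, gives the optimal nesting. Frames are built by
   Wilson's fundamental construction: in a transversal design with four groups of size m and
   two groups truncated to sizes p and q, give every point weight three groups (12 block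
   vertices); blocks, of size 4, 5 or 6, are replaced by a frame12, and groups by frame4's of
   orders m, p, q sharing one group. This yields order 4m+p+q. The transversal designs come
   from lines over a finite ring with enough elements with invertible differences: Z/m with
   gcd(m,6) = 1 in general, and F_4, F_9 for the exceptional orders 16..19 and 43. The orders
   below 16 and the three frame12's are cyclic, developed from explicit base blocks.

   Optimality. Counting star neighbours, a point x of X carries n_x nested blocks with
   (v-1) + 3 n_x <= |Y| - 1, and a point outside X at most v/3 since the blocks nested there
   are disjoint; with |Y| <= 18t+6 this leaves room for fewer than v(v-1)/3 blocks. *)
Require Import Defs.
From mathcomp Require Import all_boot all_algebra all_field zify.
Set Implicit Arguments. Unset Strict Implicit. Unset Printing Implicit Defensive.

(** * Designs on a relation: gluing and transport *)

Definition block_pairs (T : Type) (q : T * T * T * T) : seq (T * T) :=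
  let: (a, b, c, _) := q in
  [:: (a, b); (b, a); (a, c); (c, a); (b, c); (c, b)].

Definition star_pairs (T : Type) (q : T * T * T * T) : seq (T * T) :=
  let: (a, b, c, p) := q in
  [:: (a, p); (p, a); (b, p); (p, b); (c, p); (p, c)].

(** Each unordered pair is listed in both orders, so one condition on ordered pairs suffices. Where
    [R] is irreflexive, the conditions at [(x, x)] force the block vertices to be distinct and the
    nested point to lie off its block. *)
Definition design (T : eqType) (R : rel T) (X : pred T) (s : seq (T * T * T * T)) : Prop :=
  forall x y,
    count_mem (x, y) (flatten (map (@block_pairs T) s)) = 2 * [&& R x y, X x & X y] /\
    count_mem (x, y) (flatten (map (@star_pairs T) s)) <= R x y.

Definition has_design (T : eqType) (R : rel T) (X : pred T) : Prop :=
  exists s, design R X s.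

Lemma has_design0 (T : eqType) (R : rel T) (X : pred T) :
  (forall x y, R x y = false) -> has_design R X.
Proof. by move=> e; exists [::] => x y; rewrite e. Qed.

Lemma has_design_glue (T : eqType) (X : pred T) (I : eqType) (r : seq I)
    (Ri : I -> rel T) (R : rel T) :
  (forall i, i \in r -> has_design (Ri i) X) ->
  (forall x y, \sum_(i <- r) Ri i x y = R x y) -> has_design R X.
Proof.
move=> h hR.
(* Only the full sum is known to be a Boolean relation, so the induction runs on the counts with the
   sums kept as natural numbers; concatenating the lists adds both sides. *)
suff [s hs] : exists s, forall x y,
    count_mem (x, y) (flatten (map (@block_pairs T) s)) =
      2 * ((\sum_(i <- r) Ri i x y) * (X x && X y)) /\
    count_mem (x, y) (flatten (map (@star_pairs T) s)) <= \sum_(i <- r) Ri i x y.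
  exists s => x y; have [-> h2] := hs x y; rewrite hR in h2 *; split=> //.
  by rewrite mulnb.
elim: r h {hR} => [|i r IH] h; first by exists [::] => x y; rewrite big_nil.
have [|s hs] := IH; first by move=> j jr; apply: h; rewrite inE jr orbT.
have [s' hs'] := h i (mem_head _ _).
exists (s' ++ s) => x y; rewrite big_cons !map_cat !flatten_cat !count_cat.
have [-> h1] := hs x y; have [-> h2] := hs' x y; split; last exact: leq_add.
by rewrite mulnDl mulnDr mulnb.
Qed.

Lemma design_rel (T : eqType) (R : rel T) (X : pred T) s e :
  design R X s ->
  e \in flatten (map (@block_pairs T) s) ++ flatten (map (@star_pairs T) s) ->
  R e.1 e.2.
Proof.
case: e => x y hs; have [h1 h2] := hs x y.
rewrite mem_cat -!has_pred1 !has_count h1 => /orP[|h]; first by case: (R x y).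
by have := leq_trans h h2; case: (R x y).
Qed.

(** All pairs listed by a design are [R]-pairs and so lie in [D], where [f] is injective; renaming
    therefore preserves multiplicities. Since every [R']-pair comes from [D], nothing has to be
    covered outside the image. *)
Lemma has_design_map (T T' : eqType) (f : T -> T') (D : pred T)
    (R : rel T) (X : pred T) (R' : rel T') (X' : pred T') :
  {in D &, injective f} ->
  (forall x y, R x y -> D x && D y) ->
  {in D, forall x, X' (f x) = X x} ->
  {in D &, forall x y, R' (f x) (f y) = R x y} ->
  (forall x' y', R' x' y' ->
     exists x y, [/\ D x, D y, x' = f x & y' = f y]) ->
  has_design R X -> has_design R' X'.
Proof.
move=> finj RD XX RR Rim [s hs].
pose fq (q : T * T * T * T) := let: (a, b, c, p) := q in (f a, f b, f c, f p).
pose f2 (e : T * T) := (f e.1, f e.2).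
(* [E] is an arbitrary list of pairs of the design, so that the block pairs and the star pairs are
   handled by the same argument. *)
have cnt E x' y' :
    {subset E <= flatten (map (@block_pairs T) s) ++ flatten (map (@star_pairs T) s)} ->
    count_mem (x', y') (map f2 E) = 0 /\ R' x' y' = false \/
    exists x y, [/\ D x, D y, x' = f x, y' = f y &
      count_mem (x', y') (map f2 E) = count_mem (x, y) E].
  move=> hE; case hR: (R' x' y'); last first.
    left; split=> //; apply/count_memPn/mapP => -[e eE [ex ey]].
    have hr := design_rel hs (hE _ eE).
    have /andP[D1 D2] := RD _ _ hr.
    by move: hR; rewrite ex ey RR ?hr.
  have [x [y [Dx Dy -> ->]]] := Rim _ _ hR.
  right; exists x, y; split=> //; rewrite count_map; apply: eq_in_count => e eE /=.
  have /andP[D1 D2] := RD _ _ (design_rel hs (hE _ eE)).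
  case: e D1 D2 {eE} => e1 e2 /= D1 D2; rewrite /f2 /= !xpair_eqE.
  by rewrite !(inj_in_eq finj).
exists (map fq s) => x' y'.
have -> : flatten (map (@block_pairs T') (map fq s)) =
          map f2 (flatten (map (@block_pairs T) s)).
  rewrite map_flatten -!map_comp; congr flatten; apply: eq_map.
  by case=> -[[a b] c] p.
have -> : flatten (map (@star_pairs T') (map fq s)) =
          map f2 (flatten (map (@star_pairs T) s)).
  rewrite map_flatten -!map_comp; congr flatten; apply: eq_map.
  by case=> -[[a b] c] p.
split.
  have [|[-> ->]//|[x [y [Dx Dy -> -> ->]]]] :=
    cnt (flatten (map (@block_pairs T) s)) x' y'.
    by move=> e he; rewrite mem_cat he.
  by have [-> _] := hs x y; rewrite RR ?XX.
have [|[-> ->]//|[x [y [Dx Dy -> -> ->]]]] :=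
    cnt (flatten (map (@star_pairs T) s)) x' y'.
  by move=> e he; rewrite mem_cat he orbT.
by have [_] := hs x y; rewrite RR.
Qed.

(** * Frames, and the weighting of a pairwise balanced design *)

(* A vertex is a group label with a height below 6; heights 0..3 are the block vertices. The
   labels are None and three per element of Z, so that s : seq Z carries 3 |s| + 1 groups. *)
Definition point (Z : Type) := (option (Z * nat) * nat)%type.

Definition is_design_point (Z : Type) (x : point Z) := x.2 < 4.

Definition label_in (Z : eqType) (s : seq Z) (l : option (Z * nat)) :=
  if l is Some (z, i) then (z \in s) && (i < 3) else true.

Definition sep_label (Z : eqType) : rel (option (Z * nat)) := fun l l' => l != l'.

Definition sep_base (Z : eqType) : rel (option (Z * nat)) := fun l l' =>
  if (l, l') is (Some (z, _), Some (z', _)) then z != z' else false.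

Definition cross (Z : eqType) (sep : rel (option (Z * nat))) (s : seq Z) :
    rel (point Z) := fun x y =>
  [&& label_in s x.1, label_in s y.1, x.2 < 6, y.2 < 6 & sep x.1 y.1].

Definition frame (sep : forall Z : eqType, rel (option (Z * nat))) (k : nat) :=
  has_design (cross (@sep _) (iota 0 k)) (@is_design_point nat).

(* frame12 k has k groups, each made of the three labels over one element; None is unused. *)
Definition frame4 := frame sep_label.
Definition frame12 := frame sep_base.

(** The one property of a separation relation that transport needs; it lets both kinds of frame
    share [frame_transport]. *)
Definition sep_invariant (sep : forall Z : eqType, rel (option (Z * nat))) :=
  forall (Z Z' : eqType) (s : seq Z) (g : Z -> Z') l l',
    {in s &, injective g} -> label_in s l -> label_in s l' ->
    sep Z' (omap (fun zi => (g zi.1, zi.2)) l) (omap (fun zi => (g zi.1, zi.2)) l') =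
    sep Z l l'.

Lemma sep_label_invariant : sep_invariant sep_label.
Proof.
move=> Z Z' s g [[z i]|] [[z' i']|] //= gi /andP[zs _] /andP[zs' _].
rewrite /sep_label; congr (~~ _); rewrite /eq_op /= !xpair_eqE.
by rewrite (inj_in_eq gi).
Qed.

Lemma sep_base_invariant : sep_invariant sep_base.
Proof.
move=> Z Z' s g [[z i]|] [[z' i']|] //= gi /andP[zs _] /andP[zs' _].
by rewrite /sep_base /= (inj_in_eq gi).
Qed.

Lemma frame_transport (sep : forall Z : eqType, rel (option (Z * nat)))
    (Z Z' : eqType) (s : seq Z) (s' : seq Z') :
  sep_invariant sep -> sep Z' None None = false -> uniq s -> uniq s' -> size s = size s' ->
  has_design (cross (@sep Z) s) (@is_design_point Z) ->
  has_design (cross (@sep Z') s') (@is_design_point Z').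
Proof.
move=> sepI sepN us us' ss; case Es': s' => [|z0 s0].
  by move=> _; apply: has_design0 => -[[[z i]|] a] [[[z' j]|] b]; rewrite /cross //= sepN !andbF.
(* Elements at equal positions correspond. The default [z0] is the reason for treating an empty [s']
   apart, where the only label is [None] and the relation is empty. *)
rewrite -Es'; pose g z := nth z0 s' (index z s).
have gin z : z \in s -> g z \in s' by move=> zs; rewrite mem_nth // -ss index_mem.
have ginj : {in s &, injective g}.
  move=> z z' zs zs' /eqP; rewrite nth_uniq -?ss ?index_mem // => /eqP e.
  by rewrite -(nth_index z zs) e nth_index.
pose gl := omap (fun zi : Z * nat => (g zi.1, zi.2)).
pose f (x : point Z) : point Z' := (gl x.1, x.2).
pose D (x : point Z) := label_in s x.1 && (x.2 < 6).
have linj : {in label_in s &, injective gl}.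
  move=> [[z i]|] [[z' i']|] //= /andP[zs _] /andP[zs' _] [e ->].
  by rewrite (ginj _ _ zs zs' e).
have lin l : label_in s l -> label_in s' (gl l).
  by case: l => [[z i]|] //= /andP[/gin-> ->].
have lim l' : label_in s' l' -> exists2 l, label_in s l & l' = gl l.
  case: l' => [[z' i]|] /=; last by exists None.
  case/andP=> zs' i3.
  have hs : index z' s' < size s by rewrite ss index_mem.
  have [z1 _] : exists z1 : Z, True by move: hs; case: (s) => [|z1 ?] //; exists z1.
  exists (Some (nth z1 s (index z' s'), i)); first by rewrite /= mem_nth.
  by rewrite /= /g index_uniq // nth_index.
apply: (has_design_map (f := f) (D := D)).
- move=> [l a] [l' b] /andP[/= l1 a1] /andP[/= l2 b1] [e ->].
  by rewrite (linj _ _ l1 l2 e).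
- by move=> x y /and5P[l1 l2 a1 a2 _]; rewrite /D l1 l2 a1.
- by [].
- move=> [l a] [l' b] /andP[/= l1 a1] /andP[/= l2 b1].
  by rewrite /cross /= l1 l2 a1 b1 !lin //=; apply: (sepI _ _ s).
- move=> [l a] [l' b] /and5P[/= l1 l2 a1 b1 _].
  have [k k1 ->] := lim _ l1; have [k' k1' ->] := lim _ l2.
  by exists (k, a), (k', b); split; rewrite // /D /= ?k1 ?k1'.
Qed.

Lemma frame4_transport (Z Z' : eqType) (s : seq Z) (s' : seq Z') :
  uniq s -> uniq s' -> size s = size s' ->
  has_design (cross (@sep_label Z) s) (@is_design_point Z) ->
  has_design (cross (@sep_label Z') s') (@is_design_point Z').
Proof. by apply: frame_transport; first exact: sep_label_invariant. Qed.

Lemma frame12_transport (Z Z' : eqType) (s : seq Z) (s' : seq Z') :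
  uniq s -> uniq s' -> size s = size s' ->
  has_design (cross (@sep_base Z) s) (@is_design_point Z) ->
  has_design (cross (@sep_base Z') s') (@is_design_point Z').
Proof. by apply: frame_transport; first exact: sep_base_invariant. Qed.

(** Weighting step of Wilson's construction: each element of [s] carries three labels. The groups
    partition [s], and two distinct elements meet in exactly one group or block. The frames put on
    the groups all share the label [None]; they cover the pairs of labels within a group, including
    those over one element and those with [None], while the frames on blocks cover labels over
    distinct elements. *)
Lemma frame4_of_pbd (Z : eqType) (s : seq Z) (groups blocks : seq (seq Z)) :
  uniq s -> all uniq groups -> all uniq blocks ->
  (forall z, \sum_(g <- groups) (z \in g) = (z \in s)) ->
  (forall z z', z != z' ->
     \sum_(g <- groups) ((z \in g) && (z' \in g)) +
     \sum_(b <- blocks) ((z \in b) && (z' \in b)) = (z \in s) && (z' \in s)) ->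
  (forall g, g \in groups -> frame4 (size g)) ->
  (forall b, b \in blocks -> frame12 (size b)) ->
  frame4 (size s).
Proof.
move=> us ug ub h1 h2 hg hb.
apply: (frame4_transport us (iota_uniq _ _)); first by rewrite size_iota.
pose Ri (i : bool * seq Z) := if i.1 then cross (@sep_label Z) i.2 else cross (@sep_base Z) i.2.
apply: (@has_design_glue _ _ _
  ([seq (true, g) | g <- groups] ++ [seq (false, b) | b <- blocks]) Ri).
  move=> i; rewrite mem_cat => /orP[] /mapP[g gin ->] /=.
    rewrite /Ri /=; apply: (@frame4_transport nat Z (iota 0 (size g))).
    - exact: iota_uniq.
    - exact: (allP ug).
    - by rewrite size_iota.
    - exact: hg.
  rewrite /Ri /=; apply: (@frame12_transport nat Z (iota 0 (size g))).
  - exact: iota_uniq.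
  - exact: (allP ub).
  - by rewrite size_iota.
  - exact: hb.
move=> [l a] [l' b]; rewrite big_cat !big_map /Ri /=.
under eq_bigr do rewrite /cross /=.
under [X in _ + X]eq_bigr do rewrite /cross /=.
rewrite /cross /=.
case a6: (a < 6); last first.
  by rewrite !big1 ?andbF // => j _; rewrite !andbF.
case b6: (b < 6); last first.
  by rewrite !big1 ?andbF // => j _; rewrite !andbF.
rewrite /=.
case: l l' => [[z i]|] [[z' i']|]; rewrite /sep_label /sep_base /= ?eqxx ?andbF ?andbT;
  try by under [X in _ + X]eq_bigr do rewrite ?andbF; rewrite !big1_eq ?addn0.
- case i3: (i < 3); last first.
    by rewrite !big1 ?andbF // => j _; rewrite !andbF.
  case i3': (i' < 3); last first.
    by rewrite !big1 ?andbF // => j _; rewrite !andbF.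
  (* Over a single element blocks separate nothing, and exactly one group contains it. Over two
     elements the pair is covered once by a group or a block, which is [h2]. *)
  have [<-|zz] := eqVneq z z'.
    under [X in _ + X]eq_bigr do rewrite !andbF.
    rewrite big1_eq addn0; case: eqP => [_|_] /=.
      by rewrite big1 ?andbF // => j _; rewrite !andbF.
    under eq_bigr do rewrite !andbT andbb.
    by rewrite h1 !andbT andbb.
  have -> : (Some (z, i) == Some (z', i')) = false.
    by apply/eqP => -[/eqP]; rewrite (negbTE zz).
  rewrite /= !andbT -h2 //; congr (_ + _); by apply: eq_bigr => g _; rewrite !andbT.
- case: (i < 3); last by rewrite !big1 ?andbF // => j _; rewrite !andbF.
  rewrite [X in _ + X]big1 ?addn0; last by move=> j _; rewrite andbF.
  by under eq_bigr do rewrite !andbT; rewrite h1 !andbT.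
- case: (i' < 3); last by rewrite !big1 ?andbF // => j _; rewrite !andbF.
  rewrite [X in _ + X]big1 ?addn0; last by move=> j _; rewrite andbF.
  by under eq_bigr do rewrite !andbT; rewrite h1 !andbT.
Qed.

(** * Truncated transversal designs from lines over a finite ring *)

Section TransversalDesign.
Import GRing.Theory.
Local Open Scope ring_scope.

Variables (R : finComUnitRingType) (slope : nat -> R) (width : nat -> nat).

(* The block of (a, b) meets level i < 5 in slope i * a + b, and level 5 in a. *)
Definition td_value (i : nat) (ab : R * R) : R :=
  if i == 5 then ab.1 else ab.2 + slope i * ab.1.

Definition td_fibre (i : nat) : seq R := take (width i) (enum R).

Definition td_points : seq (nat * R) :=
  flatten [seq [seq (i, x) | x <- td_fibre i] | i <- iota 0 6].

Definition td_groups : seq (seq (nat * R)) :=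
  [seq [seq (i, x) | x <- td_fibre i] | i <- iota 0 6].

Definition td_block (ab : R * R) : seq (nat * R) :=
  [seq z <- [seq (i, td_value i ab) | i <- iota 0 6] | z.2 \in td_fibre z.1].

(** Restricting to levels that keep a point matters for the field of four elements: with level 4
    emptied, four slopes remain, and it has just enough of them. *)
Hypothesis slope_unit : forall i j, (i < 5)%N -> (j < 5)%N -> i != j ->
  (0 < width i)%N -> (0 < width j)%N -> slope i - slope j \is a GRing.unit.

Lemma mem_td_group i (z : nat * R) :
  (z \in [seq (i, x) | x <- td_fibre i]) = (z.1 == i) && (z.2 \in td_fibre z.1).
Proof.
apply/mapP/andP => [[x xi ->]|[/eqP <- h]]; first by rewrite eqxx.
by exists z.2; rewrite // -surjective_pairing.
Qed.

Lemma sum_iota6 (P : nat -> bool) k :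
  (\sum_(i <- iota 0 6) ((k == i) && P i) = ((k < 6) && P k))%N.
Proof.
rewrite (bigID (pred1 k)) /= addnC big1 ?add0n => [|i /negbTE ik]; last first.
  by rewrite eq_sym ik.
rewrite (eq_bigr (fun=> nat_of_bool (P k))) => [|i /eqP->]; last by rewrite eqxx.
rewrite big_const_seq iter_addn_0 (count_uniq_mem k (iota_uniq 0 6)) mem_iota.
by rewrite mulnC mulnb.
Qed.

Lemma mem_td_points (z : nat * R) :
  (z \in td_points) = (z.1 < 6)%N && (z.2 \in td_fibre z.1).
Proof.
apply/flatten_mapP/andP => [[i]|[z6 zf]].
  by rewrite mem_iota mem_td_group => /andP[_ ?] /andP[/eqP-> ->].
by exists z.1; rewrite ?mem_iota // mem_td_group eqxx.
Qed.

Lemma mem_td_block ab (z : nat * R) :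
  (z \in td_block ab) = (z \in td_points) && (td_value z.1 ab == z.2).
Proof.
rewrite mem_filter mem_td_points andbC.
have -> : (z \in [seq (i, td_value i ab) | i <- iota 0 6]) =
          (z.1 < 6)%N && (td_value z.1 ab == z.2).
  apply/mapP/andP => [[i]|[z6 /eqP e]].
    by rewrite mem_iota => /andP[_ ?] ->.
  by exists z.1; rewrite ?mem_iota // e -surjective_pairing.
by rewrite andbAC.
Qed.

Lemma td_points_uniq : uniq td_points.
Proof.
rewrite /td_points; apply: allpairs_uniq_dep.
- exact: iota_uniq.
- by move=> i _; rewrite take_uniq ?enum_uniq.
- by case=> i x [j y] _ _ /= [-> ->].
Qed.

Lemma sum_td_groups (z : nat * R) : (\sum_(g <- td_groups) (z \in g) = (z \in td_points))%N.
Proof.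
rewrite big_map; under eq_bigr do rewrite mem_td_group.
by rewrite (sum_iota6 (fun=> z.2 \in td_fibre z.1)) mem_td_points.
Qed.

Lemma unit_eq_mul (u v w : R) : u \is a GRing.unit -> (u * v == w) = (v == u^-1 * w).
Proof. by move=> uu; rewrite -[RHS](inj_eq (mulrI uu)) mulVKr. Qed.

(** Two points on different levels give two linear equations in [(a, b)]. Below level 5 the
    determinant is a difference of slopes, a unit; level 5 prescribes [a] outright. *)
Lemma td_line (i j : nat) (x y : R) :
  (i < j < 6)%N -> (0 < width i)%N -> (0 < width j)%N ->
  (\sum_(ab : R * R) ((td_value i ab == x) && (td_value j ab == y)) = 1)%N.
Proof.
move=> /andP[ij j6] wi wj.
have i5 : (i < 5)%N by apply: leq_trans ij _.
suff [ab0 h] : exists ab0 : R * R, forall ab,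
    (td_value i ab == x) && (td_value j ab == y) = (ab == ab0).
  by rewrite (eq_bigr (fun ab => nat_of_bool (ab == ab0))) => [|ab _];
    rewrite ?h // -big_mkcond /= big_pred1_eq.
rewrite /td_value (ltn_eqF i5).
have [j5|nj5] := eqVneq j 5.
  exists (y, x - slope i * y) => -[a b] /=; rewrite xpair_eqE andbC.
  by case: eqP => //= ->; rewrite [RHS]eq_sym subr_eq eq_sym.
have j5 : (j < 5)%N by rewrite ltn_neqAle nj5.
have uu : slope j - slope i \is a GRing.unit.
  by apply: slope_unit; rewrite // neq_ltn ij orbT.
exists ((slope j - slope i)^-1 * (y - x),
        x - slope i * ((slope j - slope i)^-1 * (y - x))) => -[a b] /=.
rewrite xpair_eqE -unit_eq_mul //.
have -> : (b + slope i * a == x) = (b == x - slope i * a).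
  by rewrite [RHS]eq_sym subr_eq eq_sym.
case: (b =P x - slope i * a) => [->|hb] /=.
  have -> : (x - slope i * a + slope j * a == y) = ((slope j - slope i) * a == y - x).
    by rewrite mulrBl [RHS]eq_sym subr_eq [RHS]eq_sym addrAC [in RHS]addrC addrA.
  case: eqP => [<-|//] /=; apply/esym/eqP; congr (x - slope i * _).
  by apply: (mulrI uu); rewrite mulVKr.
apply/esym/negbTE/negP => /andP[/eqP e /eqP hb']; apply: hb; rewrite hb'; congr (x - slope i * _).
by apply: (mulrI uu); rewrite mulVKr // e.
Qed.

Lemma width_gt0 i x : x \in td_fibre i -> (0 < width i)%N.
Proof. by rewrite /td_fibre; case: (width i) => //; rewrite take0. Qed.

Lemma td_pair (z z' : nat * R) : z.1 != z'.1 ->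
  (\sum_(b <- [seq td_block ab | ab <- enum {: R * R}]) ((z \in b) && (z' \in b)) =
   (z \in td_points) && (z' \in td_points))%N.
Proof.
wlog lt : z z' / (z.1 < z'.1)%N => [hw|_].
  move=> ne; have:= ne; rewrite neq_ltn => /orP[/hw->//|/hw h].
  by rewrite andbC -h 1?eq_sym //; apply: eq_bigr => b _; rewrite andbC.
rewrite big_map big_enum /=; under eq_bigr do rewrite !mem_td_block.
case hz : (z \in td_points); last by rewrite big1.
case hz' : (z' \in td_points); last by rewrite big1 // => ab _; rewrite andbF.
move: hz hz'; rewrite !mem_td_points => /andP[_ /width_gt0 w] /andP[l /width_gt0 w'].
by rewrite /= td_line ?lt.
Qed.

(** The levels are the groups and the truncated lines the blocks. A line keeps its four points on
    the full levels and at most one more on each of levels 4 and 5, which yields the block sizes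
    required of [frame12]. *)
Lemma frame4_of_td :
  (forall i, (i < 6)%N -> (width i <= #|R|)%N) ->
  (forall i, (i < 4)%N -> width i = #|R|) ->
  (forall i, (i < 6)%N -> frame4 (width i)) ->
  (forall k, (4 <= k <= 4 + (0 < width 4) + (0 < width 5))%N -> frame12 k) ->
  frame4 (\sum_(i < 6) width i).
Proof.
move=> wR w4 hf4 hf12.
have sizeF i : (i < 6)%N -> size (td_fibre i) = width i.
  by move=> i6; rewrite size_takel // -cardE wR.
have -> : (\sum_(i < 6) width i)%N = size td_points.
  rewrite size_flatten /shape -map_comp sumnE big_map -(big_mkord xpredT) big_seq.
  rewrite [RHS]big_seq; apply: eq_bigr => i; rewrite mem_index_iota => /andP[_ i6].
  by rewrite /= size_map sizeF.
apply: (@frame4_of_pbd _ td_points td_groups [seq td_block ab | ab <- enum {: R * R}]).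
- exact: td_points_uniq.
- apply/allP => g /mapP[i _ ->]; rewrite map_inj_uniq ?take_uniq ?enum_uniq //.
  by move=> x y [].
- apply/allP => b /mapP[ab _ ->]; rewrite filter_uniq // map_inj_uniq ?iota_uniq //.
- by move=> z; apply: sum_td_groups.
- move=> z z' zz'; have [e|ne] := eqVneq z.1 z'.1.
    (* A line has one value per level, so no block contains two distinct points of one level. *)
    rewrite [X in (_ + X)%N]big1_seq ?addn0; last first.
      move=> b /= /mapP[ab _ ->]; rewrite !mem_td_block -e.
      case: eqP => [e1|]; last by rewrite !andbF.
      case: eqP => [e2|]; last by rewrite !andbF.
      by case/eqP: zz'; rewrite (surjective_pairing z) (surjective_pairing z') e -e1 -e2.
    rewrite big_map; under eq_bigr do rewrite !mem_td_group -e.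
    under eq_bigr do rewrite andbACA andbb.
    rewrite (sum_iota6 (fun=> (z.2 \in td_fibre z.1) && (z'.2 \in td_fibre z.1))).
    by rewrite !mem_td_points -e andbACA andbb.
  rewrite td_pair // big_map big1 // => i _; rewrite !mem_td_group.
  by case: eqP => //= <-; rewrite eq_sym (negbTE ne) andbF.
- move=> g /mapP[i]; rewrite mem_iota => /andP[_ i6] ->.
  by rewrite size_map sizeF //; apply: hf4.
- move=> b /mapP[ab _ ->]; apply: hf12.
  rewrite /td_block size_filter.
  have full i : (i < 4)%N -> td_value i ab \in td_fibre i.
    by move=> i4; rewrite /td_fibre w4 // cardE take_size mem_enum.
  have small i v : (v \in td_fibre i <= (0 < width i))%N.
    by rewrite /td_fibre; case: (width i) => [|w]; rewrite ?take0 ?leq_b1.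
  rewrite /= !(full 0, full 1, full 2, full 3) // addn0 -!addnA !add1n !addSn add0n.
  by rewrite !ltnS leq0n /= leq_add ?small.
Qed.

End TransversalDesign.

(** * The method of differences *)

Section CyclicFrame.

Variables (k u : nat).
Hypothesis u_gt0 : 0 < u.
Hypothesis k_gt0 : 0 < k.

(* Block vertices (false, x) with x mod 2ku and further points (true, c) with c mod ku; the
   groups are the residue classes mod u. Base triples are nested at (false, 0) or (true, 0). *)
Definition modulus (b : bool) : nat := if b then k * u else 2 * (k * u).

Definition cyc_shift (j : nat) (x : bool * nat) : bool * nat :=
  (x.1, (x.2 + j) %% modulus x.1).

(** The orbit invariant of a pair under simultaneous shifts: the types of its ends and their
    difference. As [k * u] divides [2 * (k * u)], a pair with a further point has a difference only
    modulo [k * u]. *)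
Definition cyc_diff (e : (bool * nat) * (bool * nat)) : bool * bool * nat :=
  let m := modulus (e.1.1 || e.2.1) in
  (e.1.1, e.2.1, (e.2.2 + (m - e.1.2 %% m)) %% m).

Definition cyc_quad (c : bool) (t : nat * nat * nat) :=
  let: (x, y, z) := t in ((false, x), (false, y), (false, z), (c, 0)).

Definition cyc_base (nested coloured : seq (nat * nat * nat)) :=
  map (cyc_quad false) nested ++ map (cyc_quad true) coloured.

(** Among block vertices, each difference not divisible by [u] must occur exactly twice in base
    blocks; in base stars, such a difference occurs at most once for each pair of types. Differences
    divisible by [u], which stay inside a group, must not occur. *)
Definition cyc_check (nested coloured : seq (nat * nat * nat)) : bool :=
  let s := cyc_base nested coloured in
  let d1 := map cyc_diff (flatten (map (@block_pairs _) s)) in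
  let d2 := map cyc_diff (flatten (map (@star_pairs _) s)) in
  let ds := iota 0 (2 * (k * u)) in
  all (fun bb : bool * bool => all (fun d =>
    (count_mem (bb, d) d1 == 2 * [&& d %% u != 0, ~~ bb.1 & ~~ bb.2]) &&
    (count_mem (bb, d) d2 <= (d %% u != 0)))
    ds) [:: (false, false); (false, true); (true, false); (true, true)].

Definition cyc_cross : rel (bool * nat) := fun x y =>
  [&& x.2 < modulus x.1, y.2 < modulus y.1 & x.2 %% u != y.2 %% u].

Lemma modulus_gt0 b : 0 < modulus b.
Proof. by rewrite /modulus; case: b; rewrite !muln_gt0 ?u_gt0 ?k_gt0. Qed.

Lemma dvdn_u_modulus b : u %| modulus b.
Proof. by case: b; rewrite /modulus ?mulnA dvdn_mull. Qed.

Lemma dvdn_modulus b c : modulus (b || c) %| modulus c.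
Proof. by case: b c => -[] //; apply: dvdn_mull. Qed.

Lemma sub_mod_eq m x y x' y' : 0 < m ->
  (y + (m - x %% m) == y' + (m - x' %% m) %[mod m]) = (y + x' == y' + x %[mod m]).
Proof.
move=> m0; rewrite -(eqn_modDr (x + x')).
have E y1 x1 z : y1 + (m - x1 %% m) + (x1 + z) = y1 + z %[mod m].
  rewrite addnA -modnDml.
  have -> : y1 + (m - x1 %% m) + x1 = y1 %[mod m].
    by rewrite -addnA -modnDmr -(modnDmr _ x1) subnK ?modnn ?addn0 // ltnW ?ltn_mod.
  by rewrite modnDml.
by rewrite E [x + x']addnC E.
Qed.

(** The first equation fixes the shift as [x - a] modulo [n]. As [m] divides [n], the second
    equation then becomes a congruence free of [j]. *)
Lemma sum_shifts n m a b x y : 0 < n -> m %| n ->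
  \sum_(j <- iota 0 n) (((a + j) %% n == x) && ((b + j) %% m == y)) =
  [&& x < n, y < m & b + x == y + a %[mod m]].
Proof.
move=> n0 mn; have m0 := dvdn_gt0 n0 mn.
case: (ltnP x n) => [xn|nx] /=; last first.
  rewrite big1 // => j _; case: eqP => //= e.
  by have := leq_trans (ltn_pmod (a + j) n0) nx; rewrite e ltnn.
case: (ltnP y m) => [ym|my] /=; last first.
  rewrite big1 // => j _; rewrite andbC; case: eqP => //= e.
  by have := leq_trans (ltn_pmod (b + j) m0) my; rewrite e ltnn.
pose j0 := (x + (n - a %% n)) %% n.
have j0E j : j < n -> ((a + j) %% n == x) = (j == j0).
  move=> jn; rewrite -{1}(modn_small xn) -{2}(modn_small jn) /j0.
  have := @sub_mod_eq n 0 j a x n0; rewrite mod0n subn0 modnDr !addn0 => ->.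
  by rewrite addnC.
rewrite (bigID (pred1 j0)) /= [X in _ + X]big1_seq ?addn0 => [|j]; last first.
  by case/andP=> /negbTE ne; rewrite mem_iota => /andP[_ jn]; rewrite j0E // ne.
have j0n : j0 < n by rewrite ltn_mod.
rewrite (eq_bigr (fun=> nat_of_bool (b + x == y + a %[mod m]))) => [|j /eqP->].
  rewrite big_const_seq iter_addn_0 (count_uniq_mem _ (iota_uniq 0 n)) mem_iota.
  by rewrite j0n muln1.
rewrite j0E // eqxx /=; congr nat_of_bool.
have xE : x = a + j0 %[mod m].
  by rewrite -(modn_dvdm (a + j0) mn); have/eqP -> : (a + j0) %% n == x by rewrite j0E.
rewrite -[y in LHS](modn_small ym) -(modnDmr b x) xE modnDmr.
by rewrite addnCA [y + a]addnC eqn_modDl.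
Qed.

Lemma cyc_diff_mod (x y : bool * nat) :
  ((cyc_diff (x, y)).2 %% u != 0) = (x.2 %% u != y.2 %% u).
Proof.
rewrite /cyc_diff /=; set m := modulus _; have um : u %| m := dvdn_u_modulus _.
have m0 : 0 < m := modulus_gt0 _.
rewrite (modn_dvdm _ um); congr (~~ _).
rewrite -{1}(mod0n u) -(eqn_modDr (x.2 %% m)) add0n -addnA subnK ?(ltnW (ltn_pmod _ m0)) //.
rewrite (modn_dvdm _ um) -modnDmr (eqP um) addn0 eq_sym.
by [].
Qed.

(** One end of [e] is a block vertex, whose orbit has the full length [2 * (k * u)], so at most one
    shift carries [e] to a given pair. A pair of two further points would be hit twice, whence the
    assumption. *)
Lemma count_shifts (e : (bool * nat) * (bool * nat)) x y : ~~ (e.1.1 && e.2.1) ->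
  \sum_(j <- iota 0 (2 * (k * u))) ((cyc_shift j e.1, cyc_shift j e.2) == (x, y)) =
  [&& x.2 < modulus x.1, y.2 < modulus y.1 & cyc_diff e == cyc_diff (x, y)].
Proof.
case: e x y => -[c a] [c' b] [d x] [d' y] /=; rewrite /cyc_diff /cyc_shift /= => cc.
case: (c =P d) => [<-|ne]; last first.
  rewrite big1 => [|j _]; first by rewrite !xpair_eqE (introF eqP ne) /= !andbF.
  by rewrite !xpair_eqE (introF eqP ne).
case: (c' =P d') => [<-|ne]; last first.
  rewrite big1 => [|j _]; first by rewrite !xpair_eqE (introF eqP ne) /= !andbF.
  by rewrite !xpair_eqE (introF eqP ne) /= andbF.
under eq_bigr do rewrite !xpair_eqE !eqxx /=.
rewrite !xpair_eqE !eqxx /= sub_mod_eq ?modulus_gt0 //.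
case: c c' cc => -[] //= _.
- rewrite -[2 * (k * u)]/(modulus false).
  (* The first end is a further point here; the ends are swapped so that the one with the full
     modulus determines the shift. *)
  under eq_bigr do rewrite andbC.
  rewrite sum_shifts ?modulus_gt0 ?(dvdn_modulus true false) //.
  by rewrite andbCA [b + x]addnC [y + a]addnC eq_sym.
- by rewrite -[2 * (k * u)]/(modulus false) sum_shifts ?modulus_gt0 ?(dvdn_modulus true false).
- by rewrite -[2 * (k * u)]/(modulus false) sum_shifts ?modulus_gt0.
Qed.

Definition cyc_shift_quad (j : nat)
    (q : (bool * nat) * (bool * nat) * (bool * nat) * (bool * nat)) :=
  let: (a, b, c, p) := q in
  (cyc_shift j a, cyc_shift j b, cyc_shift j c, cyc_shift j p).

(** Exchanging the sums over shifts and base pairs leaves one contribution from each base pair with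
    the right difference. [pairs] stands for [block_pairs] or [star_pairs]. *)
Lemma count_orbits (pairs : forall T : Type, T * T * T * T -> seq (T * T)) s x y :
  (forall j q, pairs _ (cyc_shift_quad j q) =
     map (fun e => (cyc_shift j e.1, cyc_shift j e.2)) (pairs _ q)) ->
  (forall e, e \in flatten (map (pairs _) s) -> ~~ (e.1.1 && e.2.1)) ->
  count_mem (x, y) (flatten (map (pairs _)
    [seq cyc_shift_quad j q | q <- s, j <- iota 0 (2 * (k * u))])) =
  (x.2 < modulus x.1) && (y.2 < modulus y.1) *
    count_mem (cyc_diff (x, y)) (map cyc_diff (flatten (map (pairs _) s))).
Proof.
move=> pE hs; elim: s hs => [|q s IH] hs; first by rewrite muln0.
rewrite allpairs_cons map_cat flatten_cat count_cat IH => [|e es]; last first.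
  by apply: hs; rewrite /= mem_cat es orbT.
rewrite /= map_cat count_cat mulnDr; congr (_ + _).
have {}hs e : e \in pairs _ q -> ~~ (e.1.1 && e.2.1).
  by move=> eq; apply: hs; rewrite /= mem_cat eq.
rewrite count_flatten sumnE !big_map.
under eq_bigr do rewrite pE count_map -sum1_count big_mkcond.
rewrite exchange_big /= count_map -sum1_count big_distrr [RHS]big_mkcond /=.
rewrite big_seq [RHS]big_seq; apply: eq_bigr => e /hs he.
rewrite -[RHS]/(if cyc_diff e == cyc_diff (x, y) then _ else _) muln1.
transitivity (\sum_(j <- iota 0 (2 * (k * u)))
    nat_of_bool ((cyc_shift j e.1, cyc_shift j e.2) == (x, y))).
  by apply: eq_bigr => j _; case: eqP.
rewrite count_shifts //; case: (x.2 < _) => //=; case: (y.2 < _) => //=; case: eqP => //=.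
Qed.

Lemma cyclic_design nested coloured : cyc_check nested coloured ->
  has_design cyc_cross (fun x => ~~ x.1).
Proof.
move=> /allP chk.
pose s := cyc_base nested coloured.
exists [seq cyc_shift_quad j q | q <- s, j <- iota 0 (2 * (k * u))] => x y.
have sE q : q \in s -> exists c t, q = cyc_quad c t.
  by rewrite mem_cat => /orP[] /mapP[t _ ->]; [exists false, t|exists true, t].
have dlt : (cyc_diff (x, y)).2 < 2 * (k * u).
  rewrite /cyc_diff /=; apply: leq_trans (ltn_pmod _ (modulus_gt0 _)) _.
  by rewrite /modulus; case: (_ || _) => //; rewrite leq_pmull.
have /chk /allP /(_ (cyc_diff (x, y)).2) :
    (x.1, y.1) \in [:: (false, false); (false, true); (true, false); (true, true)].
  by case: (x.1); case: (y.1).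
rewrite mem_iota dlt => /(_ isT) /andP[/eqP h1 h2].
move: h1 h2; rewrite -[((x.1, y.1), _)]/(cyc_diff (x, y)) cyc_diff_mod -/s => h1 h2.
rewrite (count_orbits (pairs := block_pairs)) ?(count_orbits (pairs := star_pairs)).
- rewrite h1 /cyc_cross; split.
    by case: (_ < _) => //=; case: (_ < _) => //=; rewrite mul1n.
  by case: (_ < _) => //=; case: (_ < _) => //=; rewrite mul1n.
- by move=> j [[[a b] c] p].
- move=> e /flatten_mapP[q /sE[c [[[a b] d] ->]]] /=; rewrite !inE.
  by do 5 (case/orP => [/eqP->|]; first by case: c); move/eqP->; case: c.
- by move=> j [[[a b] c] p].
- move=> e /flatten_mapP[q /sE[c [[[a b] d] ->]]] /=; rewrite !inE.
  by do 5 (case/orP => [/eqP->|]; first by case: c); move/eqP->; case: c.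
Qed.

End CyclicFrame.

(** * Frames of small order from explicit base blocks *)

Lemma divn_mod_inj u x y : x %% u = y %% u -> x %/ u = y %/ u -> x = y.
Proof. by move=> e1 e2; rewrite (divn_eq x u) e1 e2 -divn_eq. Qed.

(** For [k = 2] a residue class modulo [u] has four block vertices and two further points. The
    residue becomes the label, with class 0 as [None], and the quotient by [u] the height, raised by
    4 at further points. *)
Lemma frame4_of_cyclic r nested coloured :
  cyc_check 2 (3 * r).+1 nested coloured -> frame4 r.
Proof.
move=> /cyclic_design; set u := (3 * r).+1 => /(_ isT isT) h.
pose lab l : option (nat * nat) := if l is l'.+1 then Some (l' %/ 3, l' %% 3) else None.
pose ht (x : bool * nat) := if x.1 then 4 + x.2 %/ u else x.2 %/ u.
pose f x := (lab (x.2 %% u), ht x).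
have labI : injective lab.
  by case=> [|x] [|y] // [e1 e2]; rewrite (divn_mod_inj e2 e1).
have lab_in l : l < u -> label_in (iota 0 r) (lab l).
  case: l => [|l] //= lr; rewrite mem_iota /= add0n ltn_mod andbT.
  by rewrite ltn_divLR // mulnC.
have lab_im l : label_in (iota 0 r) l -> exists2 i, i < u & l = lab i.
  case: l => [[z i]|]; last by exists 0.
  rewrite /= mem_iota add0n /= => /andP[zr i3]; exists (z * 3 + i).+1.
    change (z * 3 + i < 3 * r).
    apply: (@leq_trans (z.+1 * 3)); last by rewrite mulnC leq_mul2l zr orbT.
    by rewrite mulSn addnC ltn_add2r.
  by rewrite /= divnMDl // modnMDl divn_small // modn_small // addn0.
have htD (x : bool * nat) : x.2 < modulus 2 u x.1 ->
    (ht x < 6) && ((ht x < 4) == ~~ x.1).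
  case: x => -[] x; rewrite /modulus /ht /= => hx.
    by rewrite -[6]/(4 + 2) ltn_add2l ltn_divLR // hx /= ltnNge leq_addr.
  have h4 : x %/ u < 4 by rewrite ltn_divLR // -[4]/(2 * 2) -mulnA.
  by rewrite h4 (leq_trans h4).
have um (x : nat) : x %% u < u by rewrite ltn_mod.
apply: (has_design_map (f := f) (D := fun x => x.2 < modulus 2 u x.1)) h.
- move=> x y Dx Dy [/labI e1 e2].
  have /andP[_ /eqP b1] := htD _ Dx; have /andP[_ /eqP b2] := htD _ Dy.
  have b : x.1 = y.1 by apply: negb_inj; rewrite -b1 -b2 e2.
  rewrite (surjective_pairing x) (surjective_pairing y) b; congr pair.
  apply: (divn_mod_inj e1); move: e2; rewrite /ht b.
  by case: (y.1) => // /addnI.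
- by move=> x y /and3P[-> ->].
- by move=> x Dx; have /andP[_ /eqP] := htD _ Dx.
- move=> x y Dx Dy; have /andP[b1 _] := htD _ Dx; have /andP[b2 _] := htD _ Dy.
  move: Dx Dy; rewrite !unfold_in => Dx Dy.
  rewrite /cross /cyc_cross /= Dx Dy b1 b2 !lab_in //=.
  by rewrite /sep_label (inj_eq labI).
- have im l a : label_in (iota 0 r) l -> a < 6 ->
    exists x : bool * nat, x.2 < modulus 2 u x.1 /\ (l, a) = f x.
    move=> /lab_im[i iu ->] a6; case: (ltnP a 4) => [a4|a4].
      exists (false, a * u + i); split.
        rewrite /modulus /= mulnA; apply: (@leq_trans (a.+1 * u)).
          by rewrite mulSn addnC ltn_add2r.
        by rewrite leq_mul2r a4 orbT.
      by rewrite /f /ht /= divnMDl // modnMDl divn_small // modn_small // addn0.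
    exists (true, (a - 4) * u + i); split.
      rewrite /modulus /=; apply: (@leq_trans ((a - 4).+1 * u)).
        by rewrite mulSn addnC ltn_add2r.
      by rewrite leq_mul2r ltn_subLR // a6 orbT.
    by rewrite /f /ht /= divnMDl // modnMDl divn_small // modn_small // addn0 subnKC.
  move=> [l a] [l' b] /and5P[/= l1 l2 a6 b6 _].
  have [x [Dx ->]] := im _ _ l1 a6; have [y [Dy ->]] := im _ _ l2 b6.
  by exists x, y.
Qed.

(** For [k = 6] a residue class has twelve block vertices and six further points. The quotient by
    [u] is divided again by [w], splitting the class into three labels with four and two heights. *)
Lemma frame12_of_cyclic u nested coloured : 0 < u ->
  cyc_check 6 u nested coloured -> frame12 u.
Proof.
move=> u0 /cyclic_design -/(_ u0 isT) h.
pose w (c : bool) := if c then 2 else 4.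
pose f (x : bool * nat) := let q := x.2 %/ u in
  (Some (x.2 %% u, q %/ w x.1), (if x.1 then 4 else 0) + q %% w x.1).
have w0 c : 0 < w c by case: c.
have mE c : modulus 6 u c = 3 * w c * u by case: c; rewrite /modulus // mulnA.
have um (x : nat) : x %% u < u by rewrite ltn_mod.
have htD (x : bool * nat) : x.2 < modulus 6 u x.1 ->
    [&& x.2 %/ u %/ w x.1 < 3, (f x).2 < 6 & ((f x).2 < 4) == ~~ x.1].
  rewrite mE => hx; rewrite ltn_divLR // ltn_divLR // hx /f /=.
  case: (x.1); rewrite ?add0n.
    by rewrite -[6]/(4 + 2) ltn_add2l ltn_mod /= ltnNge leq_addr.
  have h4 : x.2 %/ u %% 4 < 4 by rewrite ltn_mod.
  by rewrite h4 (leq_trans h4).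
apply: (has_design_map (f := f) (D := fun x => x.2 < modulus 6 u x.1)) h.
- move=> x y Dx Dy e.
  have /and3P[_ _ /eqP b1] := htD _ Dx; have /and3P[_ _ /eqP b2] := htD _ Dy.
  have b : x.1 = y.1 by apply: negb_inj; rewrite -b1 -b2 e.
  case: e; rewrite b => e1 e2 /addnI e3.
  rewrite (surjective_pairing x) (surjective_pairing y) b; congr pair.
  exact: (divn_mod_inj e1 (divn_mod_inj e3 e2)).
- by move=> x y /and3P[-> ->].
- by move=> x Dx; have /and3P[_ _ /eqP] := htD _ Dx.
- move=> x y Dx Dy; have /and3P[c1 b1 _] := htD _ Dx; have /and3P[c2 b2 _] := htD _ Dy.
  move: Dx Dy; rewrite !unfold_in => Dx Dy.
  by rewrite /cross /cyc_cross Dx Dy b1 b2 /= !mem_iota !um c1 c2.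
- have im z i a : z \in iota 0 u -> i < 3 -> a < 6 ->
    exists x : bool * nat, x.2 < modulus 6 u x.1 /\ (Some (z, i), a) = f x.
    rewrite mem_iota add0n /= => zu i3 a6.
    have [c [a' a'w ->]] : exists c : bool, exists2 a', a' < w c & a = (if c then 4 else 0) + a'.
      case: (ltnP a 4) => a4; first by exists false, a.
      by exists true, (a - 4); rewrite ?subnKC // ltn_subLR.
    exists (c, (i * w c + a') * u + z); split.
      rewrite mE /=; apply: (@leq_trans ((i * w c + a').+1 * u)).
        by rewrite mulSn addnC ltn_add2r.
      rewrite leq_mul2r; apply/orP; right; apply: (@leq_trans (i.+1 * w c)).
        by rewrite mulSn addnC ltn_add2r.
      by rewrite leq_mul2r i3 orbT.
    rewrite /f /= divnMDl // modnMDl (divn_small zu) (modn_small zu) addn0.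
    by rewrite divnMDl // modnMDl (divn_small a'w) (modn_small a'w) addn0.
  move=> [[[z i]|] a] [[[z' i']|] b] //; rewrite /cross /= ?andbF //.
  move=> /and5P[/andP[z1 i1] /andP[z2 i2] a6 b6 _].
  have [x [Dx ->]] := im _ _ _ z1 i1 a6; have [y [Dy ->]] := im _ _ _ z2 i2 b6.
  by exists x, y.
Qed.

(* Entry r is a frame4 of order r + 1, for k = 2 and u = 3r + 4; found by simulated annealing. *)
Definition base_blocks4 : seq (seq (nat * nat * nat) * seq (nat * nat * nat)) :=
  [::
   ([:: (9, 2, 3); (1, 11, 10)],
    [:: (6, 11, 9); (13, 15, 10)]);
   ([:: (23, 24, 8); (1, 26, 18); (13, 3, 22); (19, 16, 17)],
    [:: (20, 26, 24); (3, 8, 18); (2, 25, 19); (15, 27, 23)]);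
   ([:: (24, 35, 23); (22, 15, 13); (28, 26, 1); (6, 19, 31); (37, 11, 32); (33, 36, 2)],
    [:: (39, 23, 7); (18, 15, 32); (16, 5, 11); (9, 1, 8); (17, 34, 13); (2, 6, 24)]);
   ([:: (33, 1, 50); (35, 28, 23); (37, 43, 41); (5, 10, 25); (30, 6, 20); (16, 14, 44);
        (49, 7, 18); (31, 48, 12)],
    [:: (21, 46, 28); (36, 15, 14); (31, 37, 23); (17, 6, 29); (50, 25, 34); (1, 45, 44);
        (12, 16, 35); (48, 30, 33)]);
   ([:: (12, 29, 27); (57, 47, 33); (56, 43, 38); (44, 41, 50); (63, 24, 51); (62, 34, 5);
        (45, 60, 49); (3, 6, 28); (25, 42, 55); (18, 10, 53)],
    [:: (63, 44, 40); (50, 22, 13); (55, 3, 17); (26, 57, 33); (29, 21, 59); (56, 36, 38);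
        (10, 30, 11); (41, 20, 51); (7, 60, 2); (37, 15, 14)]);
   ([:: (18, 54, 61); (75, 12, 7); (42, 46, 14); (66, 60, 23); (4, 70, 55); (74, 27, 20);
        (63, 73, 29); (59, 11, 37); (8, 31, 71); (25, 26, 43); (40, 52, 35); (44, 48, 9)],
    [:: (16, 37, 17); (43, 70, 68); (9, 29, 15); (49, 58, 35); (13, 24, 40); (8, 60, 26);
        (61, 1, 31); (27, 72, 48); (28, 25, 36); (6, 41, 56); (21, 50, 52); (33, 42, 45)]);
   ([:: (60, 36, 41); (17, 26, 84); (5, 79, 45); (18, 3, 65); (16, 67, 2); (59, 68, 58);
        (34, 31, 77); (6, 81, 1); (56, 46, 76); (39, 51, 50); (13, 15, 40); (78, 25, 74);
        (53, 8, 24); (61, 19, 55)],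
    [:: (70, 16, 32); (8, 78, 31); (87, 59, 27); (46, 25, 33); (50, 57, 83); (1, 49, 12);
        (64, 3, 28); (24, 4, 21); (41, 73, 79); (53, 82, 84); (80, 62, 7); (81, 10, 17);
        (67, 63, 14); (86, 74, 55)]);
   ([:: (67, 28, 52); (62, 27, 57); (95, 53, 89); (30, 87, 78); (36, 24, 92);
        (35, 26, 12); (10, 46, 68); (39, 23, 56); (55, 83, 9); (7, 99, 51); (34, 97, 4);
        (81, 82, 21); (20, 6, 86); (2, 15, 84); (60, 59, 71); (42, 69, 37)],
    [:: (6, 47, 78); (34, 13, 94); (87, 83, 49); (43, 66, 40); (3, 46, 65); (92, 21, 88);
        (45, 61, 58); (27, 76, 29); (54, 30, 32); (20, 41, 35); (74, 23, 64); (12, 19, 1);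
        (89, 36, 9); (31, 48, 2); (55, 10, 18); (7, 17, 72)]);
   ([:: (61, 81, 17); (54, 53, 49); (88, 74, 42); (69, 82, 72); (35, 78, 68);
        (6, 83, 100); (26, 1, 32); (94, 11, 90); (13, 65, 109); (107, 46, 37);
        (45, 103, 92); (73, 97, 8); (7, 93, 27); (96, 21, 23); (55, 98, 110);
        (62, 102, 41); (108, 60, 36); (64, 25, 79)],
    [:: (102, 35, 73); (36, 89, 53); (16, 87, 13); (45, 107, 10); (50, 61, 24);
        (100, 70, 38); (20, 83, 1); (68, 77, 32); (26, 25, 47); (98, 8, 86); (3, 110, 11);
        (29, 71, 78); (41, 7, 96); (37, 55, 39); (108, 4, 23); (105, 18, 99);
        (90, 104, 19); (62, 2, 9)]);
   ([:: (118, 108, 75); (107, 41, 59); (86, 91, 19); (13, 68, 103); (109, 85, 113);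
        (61, 28, 44); (104, 120, 45); (102, 94, 106); (24, 66, 60); (54, 115, 55);
        (10, 78, 8); (88, 35, 27); (121, 122, 34); (52, 14, 42); (51, 101, 37);
        (53, 7, 32); (81, 119, 40); (74, 67, 48); (12, 99, 77); (95, 1, 98)],
    [:: (107, 28, 100); (2, 91, 41); (80, 109, 24); (35, 3, 16); (7, 84, 106);
        (46, 119, 37); (116, 111, 96); (21, 33, 113); (74, 60, 104); (105, 120, 5);
        (55, 66, 9); (94, 73, 121); (14, 72, 61); (8, 114, 112); (27, 102, 68);
        (20, 63, 118); (79, 39, 92); (98, 115, 75); (48, 19, 25); (26, 77, 23)]);
   ([:: (9, 36, 101); (70, 81, 60); (31, 2, 108); (4, 21, 48); (75, 20, 59);
        (38, 114, 79); (24, 89, 17); (135, 63, 7); (64, 104, 121); (30, 91, 42);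
        (37, 14, 113); (39, 86, 44); (54, 12, 11); (53, 3, 6); (103, 29, 51);
        (80, 27, 67); (46, 49, 126); (128, 43, 95); (117, 78, 84); (62, 25, 131);
        (26, 96, 71); (118, 120, 13)],
    [:: (130, 94, 12); (43, 65, 69); (16, 131, 107); (13, 19, 18); (126, 100, 47);
        (112, 128, 114); (70, 52, 77); (53, 10, 85); (135, 103, 48); (56, 129, 91);
        (108, 45, 93); (64, 36, 72); (27, 125, 3); (7, 123, 73); (66, 20, 8);
        (82, 105, 54); (41, 50, 31); (28, 59, 74); (92, 38, 51); (49, 97, 30);
        (110, 101, 90); (89, 15, 11)]);
   ([:: (13, 95, 145); (15, 109, 113); (52, 28, 73); (45, 72, 12); (2, 58, 131);
        (68, 125, 42); (55, 67, 112); (83, 118, 84); (27, 134, 59); (21, 60, 147);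
        (141, 124, 77); (99, 4, 82); (29, 110, 139); (48, 92, 40); (50, 18, 62);
        (128, 10, 122); (32, 79, 11); (140, 129, 142); (51, 33, 43); (70, 61, 85);
        (44, 16, 41); (94, 22, 117); (25, 5, 102); (34, 57, 47)],
    [:: (5, 147, 51); (129, 35, 21); (146, 59, 131); (24, 31, 91); (97, 86, 18);
        (4, 103, 45); (64, 126, 106); (44, 49, 71); (47, 8, 93); (122, 84, 53);
        (96, 41, 67); (128, 28, 110); (113, 83, 132); (60, 124, 76); (77, 136, 135);
        (42, 38, 33); (89, 120, 87); (26, 69, 104); (6, 68, 40); (56, 139, 16);
        (99, 85, 14); (70, 27, 34); (137, 140, 81); (20, 117, 75)]);
   ([:: (137, 12, 68); (131, 70, 152); (31, 45, 9); (66, 124, 75); (98, 57, 109);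
        (48, 5, 81); (88, 135, 91); (30, 7, 105); (87, 15, 121); (33, 93, 126);
        (111, 19, 64); (3, 149, 150); (38, 132, 102); (95, 18, 43); (60, 53, 22);
        (21, 113, 78); (16, 52, 1); (99, 154, 104); (32, 26, 74); (123, 119, 136);
        (77, 76, 158); (89, 35, 156); (110, 101, 118); (44, 133, 63); (17, 140, 54);
        (14, 147, 46)],
    [:: (44, 130, 32); (77, 109, 148); (78, 23, 88); (132, 2, 75); (53, 81, 106);
        (89, 87, 152); (85, 69, 51); (107, 54, 48); (123, 126, 62); (37, 14, 35);
        (100, 146, 12); (122, 102, 151); (95, 47, 137); (18, 101, 63); (141, 125, 65);
        (150, 121, 99); (111, 154, 67); (129, 136, 105); (96, 104, 84); (93, 119, 108);
        (30, 34, 144); (58, 76, 139); (6, 33, 91); (55, 60, 36); (153, 97, 3);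
        (38, 79, 10)]);
   ([:: (153, 25, 117); (58, 94, 107); (163, 10, 143); (41, 103, 71); (53, 99, 159);
        (142, 134, 4); (115, 90, 68); (120, 127, 24); (111, 164, 59); (98, 47, 130);
        (95, 79, 20); (3, 136, 60); (50, 12, 128); (85, 11, 166); (63, 156, 150);
        (80, 70, 105); (96, 48, 28); (26, 138, 126); (123, 116, 35); (133, 91, 51);
        (37, 18, 88); (40, 62, 108); (165, 167, 170); (118, 15, 149); (21, 83, 66);
        (31, 139, 32); (145, 75, 17); (1, 158, 100)],
    [:: (120, 85, 32); (157, 12, 168); (38, 139, 61); (73, 152, 103); (140, 18, 42);
        (144, 27, 88); (141, 127, 70); (158, 47, 76); (20, 24, 165); (108, 63, 49);
        (6, 9, 10); (150, 78, 163); (83, 116, 50); (126, 105, 131); (48, 125, 36);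
        (115, 170, 107); (51, 146, 14); (148, 4, 13); (161, 132, 143); (25, 117, 89);
        (153, 112, 130); (109, 68, 94); (35, 37, 142); (102, 5, 52); (65, 74, 11);
        (87, 33, 81); (80, 101, 28); (7, 155, 145)]);
   ([:: (40, 26, 153); (123, 178, 17); (133, 136, 84); (134, 155, 71); (90, 73, 24);
        (62, 72, 174); (137, 18, 163); (173, 20, 7); (106, 143, 176); (44, 16, 28);
        (114, 172, 5); (102, 35, 15); (147, 4, 66); (162, 117, 77); (175, 150, 19);
        (97, 3, 2); (121, 60, 128); (151, 183, 116); (130, 27, 42); (38, 57, 132);
        (139, 103, 85); (152, 161, 76); (129, 25, 89); (170, 64, 109); (65, 98, 104);
        (13, 43, 154); (36, 91, 115); (74, 49, 131); (83, 125, 145); (58, 105, 96)],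
    [:: (102, 58, 54); (183, 11, 9); (61, 177, 180); (118, 178, 126); (79, 109, 20);
        (161, 50, 73); (41, 175, 42); (145, 37, 141); (93, 162, 151); (33, 40, 154);
        (179, 64, 66); (108, 48, 7); (4, 137, 81); (113, 78, 107); (31, 128, 181);
        (80, 94, 67); (111, 106, 75); (130, 18, 104); (95, 39, 149); (160, 117, 122);
        (84, 105, 182); (47, 5, 32); (143, 77, 121); (155, 147, 136); (27, 174, 127);
        (28, 60, 76); (52, 135, 157); (114, 148, 23); (71, 100, 164); (98, 24, 74)])].

Lemma frame4_lt16 r : r < 16 -> frame4 r.
Proof.
case: r => [|r] r15.
  (* Order 0 has the single label [None], hence no separated pair. *)
  by apply: has_design0 => -[[[z i]|] a] [[[z' j]|] b]; rewrite /cross //= !andbF.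
have /allP chk : all (fun r => let t := nth ([::], [::]) base_blocks4 r in
    cyc_check 2 (3 * r.+1).+1 t.1 t.2) (iota 0 15) by vm_compute.
by apply: frame4_of_cyclic (chk r _); rewrite mem_iota.
Qed.

(* Entry i is a frame12 of order i + 4, for k = 6 and u = i + 4; found by simulated annealing. *)
Definition base_blocks12 : seq (seq (nat * nat * nat) * seq (nat * nat * nat)) :=
  [::
   ([:: (30, 31, 1); (37, 15, 34); (21, 26, 19); (35, 25, 2); (42, 5, 7); (10, 9, 3)],
    [:: (38, 5, 35); (6, 31, 45); (1, 39, 18); (23, 2, 37); (22, 27, 33); (19, 41, 10)]);
   ([:: (22, 28, 36); (7, 3, 44); (13, 46, 12); (6, 34, 42); (31, 9, 33); (43, 59, 56);
        (11, 23, 52); (41, 39, 2)],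
    [:: (41, 37, 19); (3, 17, 6); (44, 13, 2); (59, 16, 42); (31, 22, 38); (27, 39, 48);
        (23, 56, 24); (34, 28, 21)]);
   ([:: (61, 41, 16); (2, 37, 46); (63, 32, 28); (20, 49, 5); (68, 29, 34); (57, 1, 8);
        (53, 39, 50); (59, 21, 14); (10, 69, 65); (47, 45, 55)],
    [:: (50, 69, 49); (7, 29, 70); (59, 62, 64); (55, 38, 15); (5, 4, 61); (9, 68, 17);
        (58, 47, 8); (67, 35, 21); (46, 3, 56); (63, 16, 37)])].

Lemma frame12_456 k : 4 <= k <= 6 -> frame12 k.
Proof.
move=> /andP[k4 k6].
have /allP chk : all (fun k => let t := nth ([::], [::]) base_blocks12 (k - 4) in
    cyc_check 6 k t.1 t.2) (iota 4 3) by vm_compute.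
by apply: frame12_of_cyclic (chk k _); rewrite ?mem_iota ?k4 // (leq_trans _ k4).
Qed.

(** * Recursion to frames of every order *)

Lemma frame4_step (R : finComUnitRingType) (slope : nat -> R) p q :
  (forall i j, i < 5 -> j < 5 -> i != j -> (i < 4) && (j < 4) || (0 < p) ->
     (slope i - slope j)%R \is a GRing.unit) ->
  p <= #|R| -> q <= #|R| ->
  frame4 #|R| -> frame4 p -> frame4 q -> frame4 (4 * #|R| + p + q).
Proof.
move=> hs pR qR hR hp hq.
pose w i := if i < 4 then #|R| else if i == 4 then p else q.
have -> : 4 * #|R| + p + q = \sum_(i < 6) w i.
  by rewrite !big_ord_recl big_ord0 /w /= addn0 !addnA !mulSn addn0 !addnA.
apply: (@frame4_of_td _ slope).
- move=> i j i5 j5 ij wi wj; apply: hs => //; move: wi wj; rewrite /w.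
  case: (ltnP i 4) => i4; case: (ltnP j 4) => //= j4.
  + by have -> : j == 4 by lia.
  + by have -> : i == 4 by lia.
  + lia.
- by move=> i _; rewrite /w; case: ifP => // _; case: ifP.
- by move=> i i4; rewrite /w i4.
- by move=> i _; rewrite /w; case: ifP => // _; case: ifP.
- move=> k /andP[k4 k6]; apply: frame12_456; rewrite k4 (leq_trans k6) //.
  by case: (0 < w 4); case: (0 < w 5).
Qed.

(** The slopes are 0, 1, 2, 3, 4 in the integers modulo [m]. Up to sign their differences are 1 to
    4, which have no prime factor besides 2 and 3 and so are units. *)
Lemma frame4_step_coprime m p q : 4 < m -> coprime m 6 -> p <= m -> q <= m ->
  frame4 m -> frame4 p -> frame4 q -> frame4 (4 * m + p + q).
Proof.
move=> m4 m6; have m1 : 1 < m by apply: leq_trans m4.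
have cm : #|'Z_m| = m by rewrite card_ord Zp_cast.
have dm d : 0 < d < 5 -> (d%:R : 'Z_m)%R \is a GRing.unit.
  rewrite unitZpE //; move: m6; rewrite (coprimeMr m 2 3) => /andP[m2 m3].
  case: d => [|[|[|[|[|d]]]]] // _; first exact: coprimen1.
  by rewrite (coprimeMr m 2 2) m2.
move=> pm qm; rewrite -{1 2}cm.
apply: (@frame4_step _ (fun i => (i%:R)%R)); rewrite ?cm // => i j i5 j5 ij _.
wlog ji : i j i5 j5 ij / j < i.
  move=> h; move: (ij); rewrite neq_ltn => /orP[lt|]; last exact: h.
  by rewrite -GRing.opprB GRing.unitrN h // eq_sym.
by rewrite -GRing.natrB 1?ltnW // dm // subn_gt0 ji (leq_ltn_trans (leq_subr _ _)).
Qed.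

(** Level 4 is left empty ([p = 0]), so any four distinct field elements serve as slopes; this
    reaches orders whose ring has even size or size divisible by 3. *)
Lemma frame4_step_prime_power l e q : prime l -> 0 < e -> 3 < l ^ e -> q <= l ^ e ->
  frame4 (l ^ e) -> frame4 q -> frame4 (4 * l ^ e + q).
Proof.
move=> pl e0; have [F _ <-] := pPrimePowerField pl e0 => F4 qF hF hq.
rewrite -(addn0 (4 * _)).
apply: (@frame4_step _ (nth 0%R (enum F))) => //; last exact: frame4_lt16.
move=> i j _ _ ij; rewrite orbF => /andP[i4 j4].
by rewrite GRing.unitfE GRing.subr_eq0 nth_uniq ?enum_uniq // -cardE (leq_trans _ F4).
Qed.

Lemma frame4_all r : frame4 r.
Proof.
elim/ltn_ind: r => r IH.
(* A single [m] covers the whole interval from [4 * m] to [6 * m]: level 4 is filled first, then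
   level 5. *)
have step m : coprime m 6 -> 4 < m -> 4 * m <= r <= 6 * m -> frame4 r.
  move=> m6 m4 /andP[lo hi].
  have mr : m < r by apply: leq_trans lo; rewrite -[m.+1]add1n mulSn leq_add //; lia.
  have [le|gt] := leqP (r - 4 * m) m.
    have -> : r = 4 * m + (r - 4 * m) + 0 by lia.
    by apply: frame4_step_coprime => //; apply: IH; lia.
  have -> : r = 4 * m + m + (r - 5 * m) by lia.
  by apply: frame4_step_coprime => //; try apply: IH; lia.
have [r16|r16] := ltnP r 16; first exact: frame4_lt16.
have [r20|r20] := ltnP r 20.
  have -> : r = 4 * 2 ^ 2 + (r - 16) by lia.
  by apply: frame4_step_prime_power => //; [lia|apply: frame4_lt16|apply: frame4_lt16; lia].
have [->|r43] := eqVneq r 43.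
  have -> : 43 = 4 * 3 ^ 2 + 7 by [].
  by apply: frame4_step_prime_power => //; apply: frame4_lt16.
have cop k j : coprime j 6 -> coprime (6 * k + j) 6.
  by move=> j6; rewrite coprime_sym mulnC /coprime gcdnMDl -/(coprime _ _) coprime_sym.
pose k := r %/ 24.
have rE := divn_eq r 24; have rl : r %% 24 < 24 by rewrite ltn_mod.
(* The values of [m] coprime to 6 near [r / 4] are [6k - 1], [6k + 1] and [6k + 5], whose intervals
   start at [24k - 4], [24k + 4] and [24k + 20]. For [k = 1] the middle one ends at 42, which is why
   43 was treated apart. *)
have [lt4|ge4] := ltnP (r %% 24) 4.
  apply: (step (6 * k.-1 + 5)); rewrite ?cop // /k; lia.
have [lt20|ge20] := ltnP (r %% 24) 20.
  apply: (step (6 * k + 1)); rewrite ?cop // /k; lia.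
apply: (step (6 * k + 5)); rewrite ?cop // /k; lia.
Qed.

(** * Filling the groups: a design on all pairs *)

Definition labels (k : nat) : seq (option (nat * nat)) :=
  None :: [seq Some (z, i) | z <- iota 0 k, i <- iota 0 3].

Lemma mem_labels k l : (l \in labels k) = label_in (iota 0 k) l.
Proof.
case: l => [[z i]|] //; rewrite in_cons orFb; apply/allpairsP/andP => [[[z' i'] [zk]]|[zk i3]].
  by rewrite mem_iota => i3 [-> ->].
by exists (z, i); split=> //; rewrite mem_iota.
Qed.

Lemma labels_uniq k : uniq (labels k).
Proof.
rewrite cons_uniq; apply/andP; split; first by apply/negP => /allpairsP[[? ?] []].
by apply: allpairs_uniq; rewrite ?iota_uniq // => -[a b] [c d] _ _ /= [-> ->].
Qed.

(** The outer [None] is the added point oo; it is not the group label [None], which occurs inside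
    [Some]. *)
Definition vertices (k : nat) : seq (option (point nat)) :=
  None :: [seq Some (l, e) | l <- labels k, e <- iota 0 6].

Definition is_block_vertex (o : option (point nat)) : bool :=
  if o is Some x then is_design_point x else false.

Lemma mem_vertices k o :
  (o \in vertices k) = if o is Some x then label_in (iota 0 k) x.1 && (x.2 < 6) else true.
Proof.
case: o => [[l e]|] //; rewrite in_cons orFb -mem_labels.
apply/allpairsP/andP => [[[l' e'] [lk]]|[lk e6]].
  by rewrite mem_iota => e6 [-> ->].
by exists (l, e); split=> //; rewrite mem_iota.
Qed.

Lemma vertices_uniq k : uniq (vertices k).
Proof.
rewrite cons_uniq; apply/andP; split; first by apply/negP => /allpairsP[[? ?] []].
apply: allpairs_uniq; rewrite ?iota_uniq ?labels_uniq //.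
by move=> [a b] [c d] _ _ /= [-> ->].
Qed.

Lemma size_labels k : size (labels k) = 3 * k + 1.
Proof.
rewrite /labels -cat1s size_cat size_allpairs !size_iota.
by rewrite addnC mulnC.
Qed.

Lemma size_vertices k : size (vertices k) = 18 * k + 7.
Proof.
rewrite /vertices -cat1s size_cat size_allpairs size_labels size_iota [size [:: _]]/=.
lia.
Qed.

Lemma count_block_vertices k : count is_block_vertex (vertices k) = 12 * k + 4.
Proof.
rewrite /vertices -cat1s count_cat [X in X + _]/= add0n count_flatten sumnE !big_map.
rewrite (eq_bigr (fun=> 4)) => [|l _]; last by [].
by rewrite big_const_seq iter_addn_0 count_predT size_labels; lia.
Qed.

(** Points 0 to 3 are the block vertices of a group, 4 and 5 its further points, and 6 stands for
    oo. The four triples of a 4-set cover each pair twice; the triple nested at 0 uses star pairs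
    between block vertices, which no other star touches. *)
Lemma group_design :
  has_design (fun x y : nat => [&& x < 7, y < 7 & x != y]) (fun x => x < 4).
Proof.
exists [:: (0, 1, 2, 4); (0, 1, 3, 5); (0, 2, 3, 6); (1, 2, 3, 0)] => x y.
by do 7 (case: x => [|x]; first by do 7 (case: y => [|y] //)).
Qed.

Lemma complete_design k :
  has_design (fun x y => [&& x \in vertices k, y \in vertices k & x != y]) is_block_vertex.
Proof.
pose in_group l (o : option (point nat)) := if o is Some x then (x.1 == l) && (x.2 < 6) else true.
(* Index [None] is the frame, covering pairs across groups; [Some l] is group [l] with oo, covering
   the pairs inside the group and those with oo. *)
pose Ri (i : option (option (nat * nat))) : rel (option (point nat)) := fun o o' =>
  if i is Some l then [&& in_group l o, in_group l o' & o != o']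
  else if (o, o') is (Some x, Some y) then cross (@sep_label nat) (iota 0 k) x y else false.
apply: (@has_design_glue _ _ _ (None :: map Some (labels k)) Ri) => [i|o o'].
  case: i => [l _|_].
    pose f e : option (point nat) := if e == 6 then None else Some (l, e).
    apply: (has_design_map (f := f) (D := fun e => e < 7)) group_design.
    - move=> a b _ _; rewrite /f; case: eqP => [->|_]; case: eqP => [->|_] //.
      by case.
    - by move=> x y /and3P[-> ->].
    - by do 7 (case=> [|] //).
    - move=> x y; rewrite !unfold_in => x7 y7; rewrite x7 y7 /=.
      have fin e : e < 7 -> in_group l (f e).
        by move=> e7; rewrite /f; case: eqP => //= ne; rewrite eqxx; lia.
      rewrite !fin //= /f; case: (x =P 6) => [->|nx]; case: (y =P 6) => [->|ny] //=.
      + by apply/esym/eqP; apply: nesym.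
      + by apply/esym/eqP.
      + congr (~~ _); rewrite /eq_op /= /eq_op /= eqxx. by [].
    - have im o : in_group l o -> exists2 e, e < 7 & o = f e.
        case: o => [[l' e]|] /=; last by exists 6.
        by case/andP => /eqP-> e6; exists e; [lia|rewrite /f; case: eqP => // e'; lia].
      move=> o o' /and3P[/im[e e7 ->] /im[e' e7' ->] _].
      by exists e, e'.
  apply: (has_design_map (f := some) (D := predT)) (frame4_all k) => //.
  - by move=> x y _ _ [].
  - by move=> [x|] [y|] // _; exists x, y.
rewrite big_cons big_map /Ri !mem_vertices.
have one l (b : bool) : \sum_(l' <- labels k) ((l == l') && b) = label_in (iota 0 k) l && b.
  rewrite -mem_labels.
  case: b; last by rewrite andbF big1 // => l' _; rewrite andbF.
  rewrite andbT -(count_uniq_mem l (labels_uniq k)).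
  rewrite -sum1_count [RHS]big_mkcond; apply: eq_bigr => l' _; rewrite andbT /= eq_sym.
  by case: eqP.
case: o o' => [[l a]|] [[l' b]|] //=.
- rewrite /cross /sep_label /=; have [<-|ne] := eqVneq l l'.
    rewrite !andbF add0n.
    rewrite (eq_bigr (fun l' => nat_of_bool
        ((l == l') && [&& a < 6, b < 6 & Some (l, a) != Some (l, b)]))).
      by rewrite one; case: label_in => //=; case: (a < 6) => //=; case: (b < 6).
    by move=> l1 _; case: eqP => //=.
  rewrite big1 => [|l1 _]; last first.
    case: eqP => //= <-; rewrite [l' == l]eq_sym (negbTE ne) /=; by case: (a < 6).
  have -> : Some (l, a) != Some (l', b) by apply/eqP => -[e]; rewrite e eqxx in ne.
  rewrite addn0 !andbT; congr nat_of_bool.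
  by case: label_in; case: label_in; case: (a < 6); case: (b < 6).
- rewrite add0n (eq_bigr (fun l' => nat_of_bool ((l == l') && (a < 6)))).
    by rewrite one andbT.
  by move=> l1 _; rewrite andbT.
- rewrite add0n (eq_bigr (fun l1 => nat_of_bool ((l' == l1) && (b < 6)))).
    by rewrite one andbT.
  by move=> l1 _; rewrite andbT.
by rewrite add0n big1 // => l _; rewrite eqxx.
Qed.

(** * From lists of quadruples to indexed blocks and nestings *)

Definition block_of (T : finType) (q : T * T * T * T) : {set T} :=
  let: (a, b, c, _) := q in [set a; b; c].

Lemma count_block_pairs (T : finType) (a b c p x y : T) :
  [/\ a != b, a != c & b != c] -> x != y ->
  count_mem (x, y) (block_pairs (a, b, c, p)) =
    (x \in block_of (a, b, c, p)) && (y \in block_of (a, b, c, p)).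
Proof.
case=> ab ac bc xy; rewrite /= !inE !xpair_eqE.
rewrite ![_ == x]eq_sym ![_ == y]eq_sym.
have [xa|xa] := eqVneq x a.
  by subst x; rewrite (negbTE ab) (negbTE ac) [y == a]eq_sym (negbTE xy) /= !addn0 !add0n;
    case: (y =P b) => [->|] //; rewrite (negbTE bc).
have [xb|xb] := eqVneq x b.
  by subst x; rewrite (negbTE bc) [y == b]eq_sym (negbTE xy) /= !addn0 !add0n;
    case: (y =P a) => [->|] //; rewrite (negbTE ac).
have [xc|xc] := eqVneq x c => //=.
subst x; rewrite [y == c]eq_sym (negbTE xy) /= !addn0 !add0n orbF.
by case: (y =P a) => [->|] //; rewrite (negbTE ab).
Qed.

Lemma mem_star_pairs (T : finType) (q : T * T * T * T) x :
  x \in block_of q -> ((x, q.2) \in star_pairs q) && ((q.2, x) \in star_pairs q).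
Proof.
by case: q => -[[a b] c] p; rewrite !inE -orbA => /or3P[] /eqP->; rewrite !eqxx ?orbT.
Qed.

Lemma nesting_of_design (T : finType) (X : {set T}) s :
  design (fun x y => x != y) (mem X) s ->
  exists (b : nat) (B : 'I_b -> {set T}) (phi : 'I_b -> T),
    is_BIBD X B #|X| 3 2 /\ strong_nesting B phi.
Proof.
move=> hs; pose q := tnth (in_tuple s).
have qs i : q i \in s by apply: mem_tnth.
have cntE (pairs : T * T * T * T -> seq (T * T)) e :
    count_mem e (flatten (map pairs s)) = \sum_(i < size s) count_mem e (pairs (q i)).
  by rewrite count_flatten sumnE !big_map big_tnth.
(* Since the relation is disequality, this yields both the distinctness of the three block points
   and that the nested point is off the block. *)
have hrel i e : e \in block_pairs (q i) ++ star_pairs (q i) -> e.1 != e.2.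
  rewrite mem_cat => he; apply: (design_rel hs); rewrite mem_cat.
  by apply/orP; case/orP: he => he; [left|right]; apply/flatten_mapP; exists (q i).
have hX i e : e \in block_pairs (q i) -> e.1 \in X.
  move=> he; have [h _] := hs e.1 e.2; case: (boolP (e.1 \in X)) => // nX.
  move: h; rewrite -surjective_pairing [mem X _](negbTE nX) andbF muln0 => /eqP.
  rewrite eqn0Ngt -has_count has_pred1 => /negP[].
  by apply/flatten_mapP; exists (q i).
have hdist i : let: (a, b, c, p) := q i in
    [/\ a != b, a != c & b != c] /\ [/\ a \in X, b \in X & c \in X].
  move: (hrel i) (hX i); case: (q i) => -[[a b] c] p h1 h2.
  split; split; [apply: (h1 (a, b))|apply: (h1 (a, c))|apply: (h1 (b, c))|
    apply: (h2 (a, b))|apply: (h2 (b, a))|apply: (h2 (c, a))];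
  by rewrite !inE eqxx ?orbT.
have pairsE i x y : x != y -> count_mem (x, y) (block_pairs (q i)) =
    (x \in block_of (q i)) && (y \in block_of (q i)).
  by move: (hdist i); case: (q i) => -[[a b] c] p [h _]; apply: count_block_pairs.
exists (size s), (fun i => block_of (q i)), (fun i => (q i).2); split; split=> //.
- move=> i; move: (hdist i); case: (q i) => -[[a b] c] p [[ab ac bc] [aX bX cX]]; split.
    by apply/subsetP => x; rewrite !inE -orbA => /or3P[] /eqP->.
  rewrite /= -setUA cardsU1 cards2 !inE bc negb_or ab ac. by [].
- move=> x y xX yX xy; have [h _] := hs x y; move: h.
  rewrite xy [mem X x]xX [mem X y]yX cntE muln1 => <-.
  by rewrite -sum1dep_card big_mkcond; apply: eq_bigr => i _; rewrite pairsE //; case: ifP.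
- move=> i; apply/negP => /mem_star_pairs/andP[h _].
  by have := hrel i ((q i).2, (q i).2); rewrite mem_cat h orbT eqxx => /(_ isT).
move=> i j x y xi yj e; have [h1 _] := andP (mem_star_pairs xi).
have ne : x != (q i).2 by apply: (hrel i (x, (q i).2)); rewrite mem_cat h1 orbT.
have xe : x \in [set y; (q j).2] by rewrite -e !inE eqxx.
have pe : (q i).2 \in [set y; (q j).2] by rewrite -e !inE eqxx orbT.
have h2 : (x, (q i).2) \in star_pairs (q j).
  have /andP[y1 y2] := mem_star_pairs yj.
  move: xe pe; rewrite !inE => /orP[]/eqP e1 /orP[]/eqP e2; rewrite e1 e2 ?y1 ?y2 //.
    by case/eqP: ne; rewrite e1 e2.
  by case/eqP: ne; rewrite e1 e2.
(* Were [i] and [j] different, the pair [(x, (q i).2)] would be counted in two stars, against the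
   bound 1. *)
have ij : i = j.
  apply/eqP; apply/negPn/negP => ij.
  have [_] := hs x (q i).2; rewrite ne cntE (bigD1 i) // (bigD1 j) 1?eq_sym //=.
  rewrite leqNgt => /negP[]; rewrite addnA; apply: leq_trans (leq_addr _ _).
  by apply: (@leq_add 1 1); rewrite -has_count has_pred1.
split=> //; move: xe; rewrite -ij !inE => /orP[]/eqP // exp.
by case/eqP: ne.
Qed.

Lemma nesting_exists k : exists (X : {set 'I_(18 * k + 7)}) (b : nat)
    (B : 'I_b -> {set 'I_(18 * k + 7)}) (phi : 'I_b -> 'I_(18 * k + 7)),
  is_BIBD X B (12 * k + 4) 3 2 /\ strong_nesting B phi.
Proof.
rewrite -(size_vertices k) -(count_block_vertices k).
set V := vertices k; pose v (i : 'I_(size V)) := nth None V i.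
pose X := [set i : 'I_(size V) | is_block_vertex (v i)].
have <- : #|X| = count is_block_vertex V.
  by rewrite -sum1dep_card -sum1_count (big_nth None) big_mkord.
suff [s hs] : has_design (fun x y : 'I_(size V) => x != y) (mem X).
  by exists X; apply: nesting_of_design hs.
have V0 : 0 < size V by [].
pose f o : 'I_(size V) := insubd (Ordinal V0) (index o V).
have fE o : o \in V -> f o = index o V :> nat.
  by move=> oV; rewrite val_insubd index_mem oV.
have vf o : o \in V -> v (f o) = o by move=> oV; rewrite /v fE // nth_index.
have fv i : f (v i) = i.
  by apply: val_inj; rewrite /= fE ?mem_nth // index_uniq // vertices_uniq.
apply: (has_design_map (f := f) (D := mem V)) (complete_design k).
- by move=> o o' oV oV' e; rewrite -(vf o) // e vf.
- by move=> o o' /and3P[h h' _]; apply/andP.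
- by move=> o oV; rewrite /= inE vf.
- move=> o o' oV oV'; rewrite [o \in _]oV [o' \in _]oV' /=; congr (~~ _).
  by apply/eqP/eqP => [e|->//]; rewrite -(vf o) // e vf.
- by move=> i j _; exists (v i), (v j); rewrite !fv; split=> //; apply: mem_nth.
Qed.

(** * Optimality by counting star neighbours *)

Section LowerBound.

Variables (T : finType) (X : {set T}) (b : nat) (B : 'I_b -> {set T}) (phi : 'I_b -> T) (v : nat).
Hypotheses (hB : is_BIBD X B v 3 2) (hphi : strong_nesting B phi).

Definition nest_count (y : T) := \sum_(i < b) (phi i == y).

Lemma sum_block (i : 'I_b) : \sum_(x in X) (x \in B i) = 3.
Proof.
have [_ /(_ i)[sub <-] _] := hB.
by rewrite -big_mkcondr -sum1_card; apply: eq_bigl => x; rewrite andbC;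
  case xB: (x \in B i) => //=; rewrite (subsetP sub).
Qed.

(** Double counting of the other points on blocks through [x]: two per block, and two blocks for
    each of the [v - 1] points, so the factors 2 cancel. *)
Lemma replication x : x \in X -> \sum_(i < b) (x \in B i) = v.-1.
Proof.
move=> xX; have [cX hb hp] := hB.
apply/eqP; rewrite -(eqn_pmul2r (_ : 0 < 2)) //; apply/eqP.
transitivity (\sum_(i < b) \sum_(y in X | y != x) ((x \in B i) && (y \in B i))).
  rewrite big_distrl; apply: eq_bigr => i _ /=.
  case xi: (x \in B i); last by rewrite big1.
  by have := sum_block i; rewrite (bigD1 x) //= xi add1n => /succn_inj ->.
rewrite exchange_big /= (eq_bigr (fun=> 2)) => [|y /andP[yX yx]].
  rewrite sum_nat_const -cX (cardsD1 x X) xX /=; congr (_ * _).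
  by apply: eq_card => y; rewrite !inE andbC.
by rewrite -(hp x y xX yX) 1?eq_sym // -sum1dep_card [RHS]big_mkcond;
  apply: eq_bigr => i _; case: ifP.
Qed.

(** The second nesting condition read as simplicity of the graph of star pairs; the two disjuncts
    are the two ways of orienting an edge. *)
Lemma star_le1 x y :
  \sum_(i < b) ((x \in B i) && (phi i == y) || (phi i == x) && (y \in B i)) <= 1.
Proof.
have [_ hn] := hphi.
rewrite -big_mkcond /= sum1dep_card; apply/card_le1_eqP => i j; rewrite !inE => hi hj.
have ex k : (x \in B k) && (phi k == y) || (phi k == x) && (y \in B k) ->
    exists2 z, z \in B k & [set z; phi k] = [set x; y].
  case/orP => /andP[]; first by move=> h /eqP<-; exists x.
  by move=> /eqP<- h; exists y; rewrite // setUC.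
have [z zi ei] := ex _ hi; have [z' zj ej] := ex _ hj.
by have [] := hn i j z z' zi zj (etrans ei (esym ej)).
Qed.

(** The left side is the degree of [x] in the star graph: one neighbour from each block through [x],
    three from each block nested at [x]. Simplicity bounds it by the number of other points. *)
Lemma nest_count_in x : x \in X -> v.-1 + 3 * nest_count x <= #|T|.-1.
Proof.
move=> xX; have [hn _] := hphi.
have -> : v.-1 + 3 * nest_count x =
    \sum_(y | y != x) \sum_(i < b) ((x \in B i) && (phi i == y) || (phi i == x) && (y \in B i)).
  rewrite exchange_big /= -(replication xX) big_distrr -big_split; apply: eq_bigr => i _ /=.
  have [_ /(_ i)[sub c3] _] := hB.
  have [e|ne] := eqVneq (phi i) x.
    have xi : x \in B i = false by apply/negbTE; rewrite -e.
    rewrite xi /= muln1 add0n -c3 -sum1_card big_mkcond [RHS]big_mkcond; apply: eq_bigr => y _ /=.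
    by have [->|_] := eqVneq y x; rewrite ?xi //; case: ifP.
  rewrite muln0 addn0; case: (x \in B i) => /=; last by rewrite big1.
  rewrite (bigD1 (phi i)) //= eqxx big1 // => y /andP[_ yp].
  by rewrite eq_sym (negbTE yp).
apply: leq_trans (leq_sum _ (fun y _ => star_le1 x y)) _.
by rewrite sum1dep_card -(cardC1 x); apply: subset_leq_card; apply/subsetP => y; rewrite !inE.
Qed.

Lemma nest_count_le y : 3 * nest_count y <= v.
Proof.
have [cX _ _] := hB.
rewrite /nest_count big_distrr /=.
rewrite (eq_bigr (fun i => \sum_(x in X) ((x \in B i) && (phi i == y)))) => [|i _].
  rewrite exchange_big /= -cX -sum1_card; apply: leq_sum => x _.
  apply: leq_trans (star_le1 x y); apply: leq_sum => i _.
  by case: (_ && _).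
case: eqP => _; last by rewrite big1 // => x _; rewrite andbF.
by rewrite -(sum_block i) muln1; apply: eq_bigr => x _; rewrite andbT.
Qed.

Lemma sum_nest_count : \sum_y nest_count y = b.
Proof.
rewrite exchange_big /= (eq_bigr (fun=> 1)) ?sum1_card ?card_ord // => i _.
by rewrite (bigD1 (phi i)) //= eqxx big1 // => y; rewrite eq_sym => /negbTE->.
Qed.

Lemma block_count : 3 * b = v * v.-1.
Proof.
have [cX _ _] := hB.
transitivity (\sum_(x in X) \sum_(i < b) (x \in B i)); last first.
  by rewrite (eq_bigr (fun=> v.-1)) ?sum_nat_const ?cX // => x; apply: replication.
rewrite exchange_big /=.
by rewrite (eq_bigr (fun=> 3)) ?sum_nat_const ?card_ord 1?mulnC // => i _; apply: sum_block.
Qed.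

End LowerBound.

Lemma strong_nesting_size t (T : finType) (X : {set T}) (b : nat) (B : 'I_b -> {set T})
    (phi : 'I_b -> T) :
  is_BIBD X B (12 * t + 4) 3 2 -> strong_nesting B phi -> 18 * t + 7 <= #|T|.
Proof.
move=> hB hphi; rewrite leqNgt; apply/negP => lt; have [cX _ _] := hB.
have cC : #|~: X| <= 6 * t + 2 by have := cardsC X; rewrite cX; lia.
(* From [12t + 3 + 3n <= 18t + 5], so [3n <= 6t + 2], rounded down. *)
have hX x : x \in X -> nest_count phi x <= 2 * t.
  by move=> /(nest_count_in hB hphi); lia.
have hC y : y \in ~: X -> nest_count phi y <= 4 * t + 1.
  by move=> _; have := nest_count_le hB hphi y; lia.
have := sum_nest_count phi; rewrite (bigID (mem X)) /= => bE.
have h1 : \sum_(y in X) nest_count phi y <= (12 * t + 4) * (2 * t).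
  by rewrite -cX -sum_nat_const; apply: leq_sum.
have h2 : \sum_(y | y \notin X) nest_count phi y <= #|~: X| * (4 * t + 1).
  rewrite -sum_nat_const (eq_bigl (mem (~: X))) => [|y]; last by rewrite /= inE.
  exact: leq_sum.
have h3 : #|~: X| * (4 * t + 1) <= (6 * t + 2) * (4 * t + 1) by rewrite leq_mul2r cC orbT.
(* The bounds add up to [48t^2 + 22t + 2], whereas the number of blocks is
   [(12t + 4)(4t + 1) = 48t^2 + 28t + 4]. *)
have := block_count hB; nia.
Qed.

Theorem theorem4p8 (t : nat) (ht : 2 <= t) :
  (exists (X : {set 'I_(18 * t + 7)}) (b : nat)
          (B : 'I_b -> {set 'I_(18 * t + 7)}) (phi : 'I_b -> 'I_(18 * t + 7)),
      is_BIBD X B (12 * t + 4) 3 2 /\ strong_nesting B phi)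
  /\
  (forall (T : finType) (X : {set T}) (b : nat) (B : 'I_b -> {set T})
          (phi : 'I_b -> T),
      is_BIBD X B (12 * t + 4) 3 2 -> strong_nesting B phi ->
      18 * t + 7 <= #|T|).
Proof.
split; first exact: nesting_exists.
by move=> T X b B phi; apply: strong_nesting_size.
Qed.
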